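(* Let $\mathcal G$ be a graph, $\mathcal F_b\mathcal G$ the free bigroupoid and $\mathcal F_s\mathcal G$ the free 2-groupoid on $\mathcal G$, with units $I_b:\mathcal G\to\mathcal F_b\mathcal G$ and $I_s:\mathcal G\to\mathcal F_s\mathcal G$. Let $\Gamma:\mathcal F_b\mathcal G\to\mathcal F_s\mathcal G$ be the unique strict morphism with $\Gamma I_b=I_s$. Then $\Gamma$ is a biequivalence (weak equivalence); in particular each functor $\Gamma_{A,B}$ is faithful.
   Context: A graph $\mathcal G$ consists of a set $\mathcal G_0$ of nodes and, for each $A,B\in\mathcal G_0$, a set $\mathcal G(A,B)$ of edges; graph morphisms are maps of nodes and edges compatible with sources and targets. A bigroupoid consists of a set of 0-cells, hom-groupoids $\mathcal B(A,B)$ (objects: 1-cells; arrows: 2-cells), composition functors $*$, identity 1-cells $1_A$, inversion functors $(-)^*$ and natural isomorphisms $\mathbf a:(h*g)*f\Rightarrow h*(g*f)$, $\mathbf l:1*f\Rightarrow f$, $\mathbf r:f*1\Rightarrow f$, $\mathbf e:f^**f\Rightarrow 1$, $\mathbf i:1\Rightarrow f*f^*$ satisfying the pentagon, $(\mathrm{id}*\mathbf l)\circ\mathbf a=\mathbf r*\mathrm{id}$, and $\mathbf r_f\circ(\mathrm{id}*\mathbf e_f)\circ\mathbf a\circ(\mathbf i_f*\mathrm{id})=\mathbf l_f$. A strict morphism preserves all structure on the nose (functors on hom-groupoids commuting with $*$, $1$, $(-)^*$, $\mathbf a,\mathbf l,\mathbf r,\mathbf e,\mathbf i$). A 2-groupoid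 is a bigroupoid in which $\mathbf a,\mathbf l,\mathbf r,\mathbf e,\mathbf i$ are all identities. Every bigroupoid has an underlying graph of 0-cells and 1-cells. The free bigroupoid $\mathcal F_b\mathcal G$ comes with a graph morphism $I_b:\mathcal G\to\mathcal F_b\mathcal G$ such that for every bigroupoid $\mathcal B$ and graph morphism $F:\mathcal G\to\mathcal B$ there is a unique strict morphism $\widetilde F:\mathcal F_b\mathcal G\to\mathcal B$ with $\widetilde FI_b=F$; the free 2-groupoid $\mathcal F_s\mathcal G$ with $I_s$ has the same universal property with respect to 2-groupoids. A biequivalence $F:\mathcal A\to\mathcal B$ is a morphism such that every 0-cell $B$ of $\mathcal B$ admits a 1-cell $B\to FA'$ for some 0-cell $A'$ of $\mathcal A$, and each $F_{A,A'}$ is an equivalence of categories. *)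

(* Defs.v *)
From Stdlib Require Import Logic.

Set Implicit Arguments.

Record graph := Graph {
  g0 : Type;
  g1 : g0 -> g0 -> Type
}.

Record graph_morphism (G H : graph) := GraphMorphism {
  gm0 : g0 G -> g0 H;
  gm1 : forall x y : g0 G, g1 G x y -> g1 H (gm0 x) (gm0 y)
}.
Arguments gm0 {G H} _ _.
Arguments gm1 {G H} _ {x y} _.

Record bigroupoid := Bigroupoid {
  ob : Type;
  hom : ob -> ob -> Type;
  cell : forall {A B : ob}, hom A B -> hom A B -> Type;
  vcomp : forall {A B : ob} {f g h : hom A B}, cell g h -> cell f g -> cell f h;
  vid : forall {A B : ob} (f : hom A B), cell f f;
  vassoc : forall (A B : ob) (f g h k : hom A B)
             (a : cell h k) (b : cell g h) (c : cell f g),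
             vcomp (vcomp a b) c = vcomp a (vcomp b c);
  vidl : forall (A B : ob) (f g : hom A B) (a : cell f g), vcomp (vid g) a = a;
  vidr : forall (A B : ob) (f g : hom A B) (a : cell f g), vcomp a (vid f) = a;
  vgroupoid : forall (A B : ob) (f g : hom A B) (a : cell f g),
             exists b : cell g f, vcomp b a = vid f /\ vcomp a b = vid g;
  hcomp1 : forall {A B C : ob}, hom B C -> hom A B -> hom A C;
  hcomp2 : forall {A B C : ob} {g g' : hom B C} {f f' : hom A B},
             cell g g' -> cell f f' -> cell (hcomp1 g f) (hcomp1 g' f');
  hcomp_vcomp : forall (A B C : ob) (g g' g'' : hom B C) (f f' f'' : hom A B)
             (b' : cell g' g'') (b : cell g g') (a' : cell f' f'') (a : cell f f'),
             hcomp2 (vcomp b' b) (vcomp a' a) = vcomp (hcomp2 b' a') (hcomp2 b a);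
  hcomp_vid : forall (A B C : ob) (g : hom B C) (f : hom A B),
             hcomp2 (vid g) (vid f) = vid (hcomp1 g f);
  id1 : forall A : ob, hom A A;
  inv1 : forall {A B : ob}, hom A B -> hom B A;
  inv2 : forall {A B : ob} {f g : hom A B}, cell f g -> cell (inv1 f) (inv1 g);
  inv_vcomp : forall (A B : ob) (f g h : hom A B) (b : cell g h) (a : cell f g),
             inv2 (vcomp b a) = vcomp (inv2 b) (inv2 a);
  inv_vid : forall (A B : ob) (f : hom A B), inv2 (vid f) = vid (inv1 f);
  (* natural isomorphisms a, l, r, e, i (components are isos automatically,
     since hom-categories are groupoids) *)
  assoc : forall {A B C D : ob} (h : hom C D) (g : hom B C) (f : hom A B),
             cell (hcomp1 (hcomp1 h g) f) (hcomp1 h (hcomp1 g f));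
  assoc_nat : forall (A B C D : ob) (h h' : hom C D) (g g' : hom B C) (f f' : hom A B)
             (c : cell h h') (b : cell g g') (a : cell f f'),
             vcomp (assoc h' g' f') (hcomp2 (hcomp2 c b) a)
             = vcomp (hcomp2 c (hcomp2 b a)) (assoc h g f);
  lunit : forall {A B : ob} (f : hom A B), cell (hcomp1 (id1 B) f) f;
  lunit_nat : forall (A B : ob) (f f' : hom A B) (a : cell f f'),
             vcomp a (lunit f) = vcomp (lunit f') (hcomp2 (vid (id1 B)) a);
  runit : forall {A B : ob} (f : hom A B), cell (hcomp1 f (id1 A)) f;
  runit_nat : forall (A B : ob) (f f' : hom A B) (a : cell f f'),
             vcomp a (runit f) = vcomp (runit f') (hcomp2 a (vid (id1 A)));
  ecell : forall {A B : ob} (f : hom A B), cell (hcomp1 (inv1 f) f) (id1 A);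
  ecell_nat : forall (A B : ob) (f f' : hom A B) (a : cell f f'),
             vcomp (vid (id1 A)) (ecell f) = vcomp (ecell f') (hcomp2 (inv2 a) a);
  icell : forall {A B : ob} (f : hom A B), cell (id1 B) (hcomp1 f (inv1 f));
  icell_nat : forall (A B : ob) (f f' : hom A B) (a : cell f f'),
             vcomp (hcomp2 a (inv2 a)) (icell f) = vcomp (icell f') (vid (id1 B));
  pentagon : forall (A B C D E : ob) (k : hom D E) (h : hom C D) (g : hom B C)
             (f : hom A B),
             vcomp (assoc k h (hcomp1 g f)) (assoc (hcomp1 k h) g f)
             = vcomp (hcomp2 (vid k) (assoc h g f))
                 (vcomp (assoc k (hcomp1 h g) f) (hcomp2 (assoc k h g) (vid f)));
  triangle : forall (A B C : ob) (g : hom B C) (f : hom A B),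
             vcomp (hcomp2 (vid g) (lunit f)) (assoc g (id1 B) f)
             = hcomp2 (runit g) (vid f);
  inverse_coh : forall (A B : ob) (f : hom A B),
             vcomp (runit f)
               (vcomp (hcomp2 (vid f) (ecell f))
                  (vcomp (assoc f (inv1 f) f) (hcomp2 (icell f) (vid f))))
             = lunit f
}.

Arguments cell {b0 A B} _ _.
Arguments vcomp {b0 A B f g h} _ _.
Arguments vid {b0 A B} _.
Arguments hcomp1 {b0 A B C} _ _.
Arguments hcomp2 {b0 A B C g g' f f'} _ _.
Arguments id1 {b0} _.
Arguments inv1 {b0 A B} _.
Arguments inv2 {b0 A B f g} _.
Arguments assoc {b0 A B C D} _ _ _.
Arguments lunit {b0 A B} _.
Arguments runit {b0 A B} _.
Arguments ecell {b0 A B} _.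
Arguments icell {b0 A B} _.

Definition cast2 (B : bigroupoid) (X Y : ob B) (f f' g g' : hom B X Y)
  (p : f = f') (q : g = g') (a : cell f g) : cell f' g' :=
  match p in _ = f1 return cell f1 g' with
  | eq_refl => match q in _ = g1 return cell f g1 with eq_refl => a end
  end.

Arguments cast2 {B X Y f f' g g'} p q a.

Definition cell_heq (B : bigroupoid) (X Y : ob B) (f g f' g' : hom B X Y)
  (a : cell f g) (b : cell f' g') : Prop :=
  exists (p : f = f') (q : g = g'), cast2 p q a = b.

Arguments cell_heq {B X Y f g f' g'} a b.

Definition is_id2 (B : bigroupoid) (X Y : ob B) (f g : hom B X Y) (a : cell f g)
  : Prop := exists p : f = g, cast2 eq_refl p (vid f) = a.

Arguments is_id2 {B X Y f g} a.

Definition is_2groupoid (B : bigroupoid) : Prop :=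
  (forall (A0 B0 C D : ob B) (h : hom B C D) (g : hom B B0 C) (f : hom B A0 B0),
      is_id2 (assoc h g f)) /\
  (forall (A0 B0 : ob B) (f : hom B A0 B0), is_id2 (lunit f)) /\
  (forall (A0 B0 : ob B) (f : hom B A0 B0), is_id2 (runit f)) /\
  (forall (A0 B0 : ob B) (f : hom B A0 B0), is_id2 (ecell f)) /\
  (forall (A0 B0 : ob B) (f : hom B A0 B0), is_id2 (icell f)).

Definition underlying (B : bigroupoid) : graph := Graph (hom B).

Record strict_morphism (B C : bigroupoid) := StrictMorphism {
  sm0 : ob B -> ob C;
  sm1 : forall {X Y : ob B}, hom B X Y -> hom C (sm0 X) (sm0 Y);
  sm2 : forall {X Y : ob B} {f g : hom B X Y}, cell f g -> cell (sm1 f) (sm1 g);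
  sm2_vcomp : forall (X Y : ob B) (f g h : hom B X Y) (b : cell g h) (a : cell f g),
      sm2 (vcomp b a) = vcomp (sm2 b) (sm2 a);
  sm2_vid : forall (X Y : ob B) (f : hom B X Y), sm2 (vid f) = vid (sm1 f);
  sm1_hcomp : forall (X Y Z : ob B) (g : hom B Y Z) (f : hom B X Y),
      sm1 (hcomp1 g f) = hcomp1 (sm1 g) (sm1 f);
  sm2_hcomp : forall (X Y Z : ob B) (g g' : hom B Y Z) (f f' : hom B X Y)
      (b : cell g g') (a : cell f f'),
      cell_heq (sm2 (hcomp2 b a)) (hcomp2 (sm2 b) (sm2 a));
  sm1_id : forall X : ob B, sm1 (id1 X) = id1 (sm0 X);
  sm1_inv : forall (X Y : ob B) (f : hom B X Y), sm1 (inv1 f) = inv1 (sm1 f);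
  sm2_inv : forall (X Y : ob B) (f g : hom B X Y) (a : cell f g),
      cell_heq (sm2 (inv2 a)) (inv2 (sm2 a));
  sm_assoc : forall (W X Y Z : ob B) (h : hom B Y Z) (g : hom B X Y) (f : hom B W X),
      cell_heq (sm2 (assoc h g f)) (assoc (sm1 h) (sm1 g) (sm1 f));
  sm_lunit : forall (X Y : ob B) (f : hom B X Y),
      cell_heq (sm2 (lunit f)) (lunit (sm1 f));
  sm_runit : forall (X Y : ob B) (f : hom B X Y),
      cell_heq (sm2 (runit f)) (runit (sm1 f));
  sm_ecell : forall (X Y : ob B) (f : hom B X Y),
      cell_heq (sm2 (ecell f)) (ecell (sm1 f));
  sm_icell : forall (X Y : ob B) (f : hom B X Y),
      cell_heq (sm2 (icell f)) (icell (sm1 f))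
}.
Arguments sm0 {B C} _ _.
Arguments sm1 {B C} _ {X Y} _.
Arguments sm2 {B C} _ {X Y f g} _.

Definition sm_after_gm (G : graph) (B C : bigroupoid)
  (F : strict_morphism B C) (I : graph_morphism G (underlying B))
  : graph_morphism G (underlying C) :=
  @GraphMorphism G (underlying C) (fun x => sm0 F (gm0 I x))
    (fun x y (e : g1 G x y) => sm1 F (gm1 I e)).

Definition is_free_bigroupoid (G : graph) (FB : bigroupoid)
  (I : graph_morphism G (underlying FB)) : Prop :=
  forall (B : bigroupoid) (F : graph_morphism G (underlying B)),
    exists! Ft : strict_morphism FB B, sm_after_gm Ft I = F.

Definition is_free_2groupoid (G : graph) (FS : bigroupoid)
  (I : graph_morphism G (underlying FS)) : Prop :=
  is_2groupoid FS /\
  forall (B : bigroupoid), is_2groupoid B ->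
  forall (F : graph_morphism G (underlying B)),
    exists! Ft : strict_morphism FS B, sm_after_gm Ft I = F.

Definition is_iso2 (B : bigroupoid) (X Y : ob B) (f g : hom B X Y) (a : cell f g)
  : Prop := exists b : cell g f, vcomp b a = vid f /\ vcomp a b = vid g.

Arguments is_iso2 {B X Y f g} a.

Definition hom_equivalence (B C : bigroupoid) (F : strict_morphism B C)
  (X Y : ob B) : Prop :=
  exists (G1 : hom C (sm0 F X) (sm0 F Y) -> hom B X Y)
         (G2 : forall u v : hom C (sm0 F X) (sm0 F Y), cell u v -> cell (G1 u) (G1 v))
         (eta : forall f : hom B X Y, cell f (G1 (sm1 F f)))
         (eps : forall u : hom C (sm0 F X) (sm0 F Y), cell (sm1 F (G1 u)) u),
    (forall (u v w : hom C (sm0 F X) (sm0 F Y)) (b : cell v w) (a : cell u v),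
        G2 _ _ (vcomp b a) = vcomp (G2 _ _ b) (G2 _ _ a)) /\
    (forall u : hom C (sm0 F X) (sm0 F Y), G2 _ _ (vid u) = vid (G1 u)) /\
    (forall (f f' : hom B X Y) (a : cell f f'),
        vcomp (G2 _ _ (sm2 F a)) (eta f) = vcomp (eta f') a) /\
    (forall f : hom B X Y, is_iso2 (eta f)) /\
    (forall (u u' : hom C (sm0 F X) (sm0 F Y)) (a : cell u u'),
        vcomp a (eps u) = vcomp (eps u') (sm2 F (G2 _ _ a))) /\
    (forall u : hom C (sm0 F X) (sm0 F Y), is_iso2 (eps u)).

Definition biequivalence (B C : bigroupoid) (F : strict_morphism B C) : Prop :=
  (forall Y : ob C, exists X : ob B, inhabited (hom C Y (sm0 F X))) /\
  (forall X Y : ob B, hom_equivalence F X Y).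

Definition hom_faithful (B C : bigroupoid) (F : strict_morphism B C)
  (X Y : ob B) : Prop :=
  forall (f g : hom B X Y) (a b : cell f g), sm2 F a = sm2 F b -> a = b.

(* Main.v *)
(** In [Fb] any two parallel 2-cells are equal.  Fix an object [A] and pick one
normal form [w] in each isomorphism class of 1-cells out of [A].  Consider pairs of a
1-cell [f] with an arbitrary family of 2-cells [f * w => w'], [w'] being the normal
form of [f * w]; as 2-cells between such pairs take those commuting with the families.
They form a bigroupoid over [Fb], every generator lifts to it by choosing its family at
will, and hence [Fb] maps into it over itself: every 2-cell commutes with the families.
Thus [a * w = b * w] for parallel [a] and [b], and [w] isomorphic to the identity gives
[a = b].

The rest compares [Fs] with locally discrete 2-groupoids.  Mapping [Fs] to the
1-cells of [Fb] up to isomorphism shows that 1-cells with equal image under [Gam] are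
isomorphic; mapping it to the codiscrete groupoid on the objects of [Fb] shows that
[Gam] is injective on objects; mapping it to the image of [Gam] shows that [Gam] is onto on objects and
1-cells and that all 2-cells of [Fs] are identities. *)

From Stdlib Require Import ssreflect.
From Stdlib Require Import ProofIrrelevance FunctionalExtensionality PropExtensionality.
From Stdlib Require Import IndefiniteDescription Eqdep.
Require Import Defs.

Set Implicit Arguments.
Unset Strict Implicit.

Declare Scope cell_scope.
Local Open Scope cell_scope.
Local Notation "a \o b" := (vcomp a b) (at level 40, left associativity) : cell_scope.
Local Notation "a ** b" := (hcomp2 a b) (at level 35, right associativity) : cell_scope.
Local Notation "1_ f" := (vid f) (at level 5, f at level 4, format "1_ f") : cell_scope.

Local Arguments vassoc {b0 A B f g h k} a b c.

(** * Heterogeneous equality of 2-cells *)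

Section CellHeq.
Variables (B : bigroupoid) (X Y : ob B).

Lemma cell_heq_refl (f g : hom B X Y) (a : cell f g) : cell_heq a a.
Proof. by exists eq_refl, eq_refl. Qed.

Lemma cell_heq_trans (f g f' g' f'' g'' : hom B X Y)
  (a : cell f g) (b : cell f' g') (c : cell f'' g'') :
  cell_heq a b -> cell_heq b c -> cell_heq a c.
Proof.
move=> [p [q <-]] [p' [q' <-]].
by case: _ / p' ; case: _ / q'; case: _ / p; case: _ / q; apply: cell_heq_refl.
Qed.

Lemma is_id2_unique (f g : hom B X Y) (a b : cell f g) :
  is_id2 a -> is_id2 b -> a = b.
Proof. by move=> [p <-] [q <-]; rewrite (proof_irrelevance _ p q). Qed.

Lemma is_id2_heq (f g f' g' : hom B X Y) (a : cell f g) (b : cell f' g') :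
  is_id2 a -> is_id2 b -> f = f' -> g = g' -> cell_heq a b.
Proof.
move=> ia ib p q; exists p, q; destruct p, q; exact: is_id2_unique.
Qed.

Lemma is_id2_vid (f : hom B X Y) : is_id2 (vid f).
Proof. by exists eq_refl. Qed.

Definition id2_of_eq (f g : hom B X Y) (p : f = g) : cell f g :=
  cast2 eq_refl p (vid f).

Lemma is_id2_of_eq (f g : hom B X Y) (p : f = g) : is_id2 (id2_of_eq p).
Proof. by exists p. Qed.

Lemma is_id2_vcomp (f g h : hom B X Y) (b : cell g h) (a : cell f g) :
  is_id2 b -> is_id2 a -> is_id2 (vcomp b a).
Proof.
move=> [q <-] [p <-]; destruct q, p => /=; rewrite vidl; exact: is_id2_vid.
Qed.

End CellHeq.

Arguments id2_of_eq {B X Y f g} p.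

Lemma is_id2_hcomp2 (B : bigroupoid) (X Y Z : ob B) (g g' : hom B Y Z)
  (f f' : hom B X Y) (b : cell g g') (a : cell f f') :
  is_id2 b -> is_id2 a -> is_id2 (hcomp2 b a).
Proof.
move=> [q <-] [p <-]; destruct q, p => /=; rewrite hcomp_vid; exact: is_id2_vid.
Qed.

Lemma is_id2_inv2 (B : bigroupoid) (X Y : ob B) (f g : hom B X Y) (a : cell f g) :
  is_id2 a -> is_id2 (inv2 a).
Proof.
move=> [p <-]; destruct p => /=; rewrite inv_vid; exact: is_id2_vid.
Qed.

Lemma sm2_heq (B C : bigroupoid) (F : strict_morphism B C) (X Y : ob B)
  (f g f' g' : hom B X Y) (a : cell f g) (b : cell f' g') :
  cell_heq a b -> cell_heq (sm2 F a) (sm2 F b).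
Proof. by move=> [p [q <-]]; destruct p, q; apply: cell_heq_refl. Qed.

(** * Identity and composition of strict morphisms *)

Definition sm_idm (B : bigroupoid) : strict_morphism B B.
Proof.
by refine (@StrictMorphism B B (fun X => X) (fun _ _ f => f) (fun _ _ _ _ a => a)
  _ _ _ _ _ _ _ _ _ _ _ _) => *; (reflexivity || apply: cell_heq_refl).
Defined.

Definition sm_comp (B C D : bigroupoid) (F : strict_morphism C D)
  (K : strict_morphism B C) : strict_morphism B D.
Proof.
refine (@StrictMorphism B D (fun X => sm0 F (sm0 K X))
  (fun _ _ f => sm1 F (sm1 K f)) (fun _ _ _ _ a => sm2 F (sm2 K a))
  _ _ _ _ _ _ _ _ _ _ _ _) => *.
- by rewrite !sm2_vcomp.
- by rewrite !sm2_vid.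
- by rewrite !sm1_hcomp.
- eapply cell_heq_trans; [apply: sm2_heq; apply: sm2_hcomp | apply: sm2_hcomp].
- by rewrite !sm1_id.
- by rewrite !sm1_inv.
- eapply cell_heq_trans; [apply: sm2_heq; apply: sm2_inv | apply: sm2_inv].
- eapply cell_heq_trans; [apply: sm2_heq; apply: sm_assoc | apply: sm_assoc].
- eapply cell_heq_trans; [apply: sm2_heq; apply: sm_lunit | apply: sm_lunit].
- eapply cell_heq_trans; [apply: sm2_heq; apply: sm_runit | apply: sm_runit].
- eapply cell_heq_trans; [apply: sm2_heq; apply: sm_ecell | apply: sm_ecell].
- eapply cell_heq_trans; [apply: sm2_heq; apply: sm_icell | apply: sm_icell].
Defined.

(** * Locally discrete 2-groupoids *)

Record groupoid := Groupoid {
  gob : Type;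
  ghom : gob -> gob -> Type;
  gcomp : forall X Y Z, ghom Y Z -> ghom X Y -> ghom X Z;
  gid : forall X, ghom X X;
  ginv : forall X Y, ghom X Y -> ghom Y X;
  gcompA : forall W X Y Z (h : ghom Y Z) (g : ghom X Y) (f : ghom W X),
    gcomp (gcomp h g) f = gcomp h (gcomp g f);
  gidl : forall X Y (f : ghom X Y), gcomp (gid Y) f = f;
  gidr : forall X Y (f : ghom X Y), gcomp f (gid X) = f;
  ginvl : forall X Y (f : ghom X Y), gcomp (ginv f) f = gid X;
  ginvr : forall X Y (f : ghom X Y), gid Y = gcomp f (ginv f)
}.
Arguments gcomp {_ X Y Z} _ _.
Arguments gid {_} X.
Arguments ginv {_ X Y} _.
Arguments gcompA {_ W X Y Z} _ _ _.
Arguments gidl {_ X Y} _.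
Arguments gidr {_ X Y} _.
Arguments ginvl {_ X Y} _.
Arguments ginvr {_ X Y} _.

(** The groupoid laws, oriented accordingly, serve as the cells a, l, r, e, i. Since 2-cells are
    equality proofs, every equation between them is proof irrelevance. *)
Definition disc (D : groupoid) : bigroupoid.
Proof.
refine (@Bigroupoid (gob D) (@ghom D) (fun _ _ f g => f = g)
  (fun _ _ _ _ _ q p => eq_trans p q) (fun _ _ f => eq_refl) _ _ _ _
  (@gcomp D) (fun _ _ _ _ _ _ _ q p => f_equal2 (@gcomp D _ _ _) q p) _ _
  (@gid D) (@ginv D) (fun _ _ _ _ p => f_equal (@ginv D _ _) p) _ _
  (fun _ _ _ _ h g f => gcompA h g f) _
  (fun _ _ f => gidl f) _ (fun _ _ f => gidr f) _
  (fun _ _ f => ginvl f) _ (fun _ _ f => ginvr f) _ _ _ _);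
  try by intros; apply: proof_irrelevance.
by move=> X Y f g p; exists (eq_sym p); split; apply: proof_irrelevance.
Defined.

Lemma disc_cell_unique (D : groupoid) (X Y : ob (disc D)) (f g : hom (disc D) X Y)
  (p q : cell f g) : p = q.
Proof. exact: (@proof_irrelevance (f = g)). Qed.

Lemma disc_heq (D : groupoid) (X Y : ob (disc D)) (f g f' g' : hom (disc D) X Y)
  (p : cell f g) (q : cell f' g') : f = f' -> cell_heq p q.
Proof.
move=> e; have e' : g = g' by rewrite -(p : f = g) -(q : f' = g').
by exists e, e'; apply: disc_cell_unique.
Qed.

Lemma disc_is_2groupoid (D : groupoid) : is_2groupoid (disc D).
Proof.
have H (X Y : ob (disc D)) (f g : hom (disc D) X Y) (p : cell f g) : is_id2 p
  by exists p; apply: disc_cell_unique.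
by do !split => *; apply: H.
Qed.

Definition to_disc (B : bigroupoid) (D : groupoid) (F0 : ob B -> gob D)
  (F1 : forall X Y, hom B X Y -> ghom (F0 X) (F0 Y))
  (F2 : forall X Y (f g : hom B X Y), cell f g -> F1 X Y f = F1 X Y g)
  (Fcomp : forall X Y Z (g : hom B Y Z) (f : hom B X Y),
     F1 _ _ (hcomp1 g f) = gcomp (F1 _ _ g) (F1 _ _ f))
  (Fid : forall X, F1 _ _ (id1 X) = gid (F0 X))
  (Finv : forall X Y (f : hom B X Y), F1 _ _ (inv1 f) = ginv (F1 _ _ f)) :
  strict_morphism B (disc D).
Proof.
refine (@StrictMorphism B (disc D) F0 F1 F2 _ _ Fcomp _ Fid Finv _ _ _ _ _ _);
  try by intros; apply: disc_cell_unique.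
all: by intros; apply: disc_heq; rewrite ?Fcomp ?Fcomp ?Fid ?Finv.
Defined.

Arguments to_disc {B D} F0 F1 _ _ _ _.

(** Equalities can only go to identity 2-cells. All structure cells of [C] are identities as well,
    and parallel identities agree by [is_id2_unique]. *)
Definition from_disc (D : groupoid) (C : bigroupoid) (C2 : is_2groupoid C)
  (F0 : gob D -> ob C)
  (F1 : forall X Y, ghom X Y -> hom C (F0 X) (F0 Y))
  (Fcomp : forall X Y Z (g : ghom Y Z) (f : ghom X Y),
     F1 _ _ (gcomp g f) = hcomp1 (F1 _ _ g) (F1 _ _ f))
  (Fid : forall X, F1 _ _ (gid X) = id1 (F0 X))
  (Finv : forall X Y (f : ghom X Y), F1 _ _ (ginv f) = inv1 (F1 _ _ f)) :
  strict_morphism (disc D) C.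
Proof.
refine (@StrictMorphism (disc D) C F0 F1
  (fun _ _ f g p => id2_of_eq (f_equal (F1 _ _) p)) _ _ Fcomp _ Fid Finv _ _ _ _ _ _).
1: by intros; apply: is_id2_unique; [| apply: is_id2_vcomp]; apply: is_id2_of_eq.
1: by [].
all: case: C2 => Ca [Cl [Cr [Ce Ci]]].
all: intros; apply: is_id2_heq;
  by [ apply: is_id2_of_eq | apply: is_id2_hcomp2; apply: is_id2_of_eq
     | apply: is_id2_inv2; apply: is_id2_of_eq | rewrite /= ?Fcomp ?Fcomp ?Fid ?Finv ].
Defined.

Arguments from_disc {D C} C2 F0 F1 _ _ _.

Definition codisc (T : Type) : groupoid.
Proof.
by refine (@Groupoid T (fun _ _ => unit) (fun _ _ _ _ _ => tt) (fun _ => tt)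
  (fun _ _ _ => tt) _ _ _ _ _) => // X Y [].
Defined.

(** * Calculus of invertible 2-cells *)

Section Calculus.
Variable B : bigroupoid.

Lemma vinv_sig (X Y : ob B) (f g : hom B X Y) (a : cell f g) :
  {b : cell g f | b \o a = 1_f /\ a \o b = 1_g}.
Proof. exact: constructive_indefinite_description _ (vgroupoid _ _ _ _ _ a). Qed.

Definition vinv (X Y : ob B) (f g : hom B X Y) (a : cell f g) : cell g f :=
  proj1_sig (vinv_sig a).

Lemma vinvl (X Y : ob B) (f g : hom B X Y) (a : cell f g) : vinv a \o a = 1_f.
Proof. by case: (proj2_sig (vinv_sig a)). Qed.

Lemma vinvr (X Y : ob B) (f g : hom B X Y) (a : cell f g) : a \o vinv a = 1_g.
Proof. by case: (proj2_sig (vinv_sig a)). Qed.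

Lemma vcancel_l (X Y : ob B) (f g h : hom B X Y) (a : cell g h) (b c : cell f g) :
  a \o b = a \o c -> b = c.
Proof. by move=> /(f_equal (vcomp (vinv a))); rewrite -!vassoc vinvl !vidl. Qed.

Lemma vcancel_r (X Y : ob B) (f g h : hom B X Y) (a : cell f g) (b c : cell g h) :
  b \o a = c \o a -> b = c.
Proof.
by move=> /(f_equal (fun d => d \o vinv a)); rewrite !vassoc vinvr !vidr.
Qed.

Global Arguments vcancel_l {X Y f g h} a {b c} _.
Global Arguments vcancel_r {X Y f g h} a {b c} _.

Lemma vcompKl (X Y : ob B) (f g h : hom B X Y) (b : cell g h) (a : cell f h) :
  b \o (vinv b \o a) = a.
Proof. by rewrite -vassoc vinvr vidl. Qed.

Lemma hcomp_split_l (X Y Z : ob B) (g g' : hom B Y Z) (f f' : hom B X Y)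
  (b : cell g g') (a : cell f f') : b ** a = (b ** 1_f') \o (1_g ** a).
Proof. by rewrite -hcomp_vcomp vidl vidr. Qed.

Lemma hcomp_split_r (X Y Z : ob B) (g g' : hom B Y Z) (f f' : hom B X Y)
  (b : cell g g') (a : cell f f') : b ** a = (1_g' ** a) \o (b ** 1_f).
Proof. by rewrite -hcomp_vcomp vidl vidr. Qed.

Lemma whiskerl_vcomp (X Y Z : ob B) (g : hom B Y Z) (f f' f'' : hom B X Y)
  (b : cell f' f'') (a : cell f f') :
  1_g ** (b \o a) = (1_g ** b) \o (1_g ** a).
Proof. by rewrite -hcomp_vcomp vidl. Qed.

Lemma whiskerr_vcomp (X Y Z : ob B) (f : hom B X Y) (g g' g'' : hom B Y Z)
  (b : cell g' g'') (a : cell g g') :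
  (b \o a) ** 1_f = (b ** 1_f) \o (a ** 1_f).
Proof. by rewrite -hcomp_vcomp vidl. Qed.

Lemma assoc_natV (W X Y Z : ob B) (h h' : hom B Y Z) (g g' : hom B X Y)
  (f f' : hom B W X) (c : cell h h') (b : cell g g') (a : cell f f') :
  vinv (assoc h' g' f') \o (c ** b ** a) = ((c ** b) ** a) \o vinv (assoc h g f).
Proof.
apply: (vcancel_l (assoc h' g' f')); rewrite vcompKl -vassoc.
by rewrite assoc_nat vassoc vinvr vidr.
Qed.

(** Naturality of the invertible [lunit] recovers [a] from its whiskering. *)
Lemma whisker_id1_inj (X Y : ob B) (f g : hom B X Y) (a b : cell f g) :
  1_(id1 Y) ** a = 1_(id1 Y) ** b -> a = b.
Proof. by move=> e; apply: (vcancel_r (lunit f)); rewrite !lunit_nat e. Qed.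

Lemma whiskerr_id1_inj (X Y : ob B) (f g : hom B X Y) (a b : cell f g) :
  a ** 1_(id1 X) = b ** 1_(id1 X) -> a = b.
Proof. by move=> e; apply: (vcancel_r (runit f)); rewrite !runit_nat e. Qed.

(* Kelly's argument: whisker with the identity, then compare both sides by the
   pentagon at (1, 1, g, f) and two triangles. *)
Lemma lunit_hcomp (X Y Z : ob B) (g : hom B Y Z) (f : hom B X Y) :
  lunit (hcomp1 g f) \o assoc (id1 Z) g f = lunit g ** 1_f.
Proof.
apply: whisker_id1_inj; rewrite whiskerl_vcomp.
apply: (vcancel_r (assoc (id1 Z) (hcomp1 (id1 Z) g) f)).
apply: (vcancel_r (assoc (id1 Z) (id1 Z) g ** 1_f)).
rewrite !vassoc -pentagon -vassoc triangle -hcomp_vid -assoc_nat.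
by rewrite -vassoc -assoc_nat vassoc -whiskerr_vcomp triangle.
Qed.

(* The coherence of e and i, tensored with x. *)
Lemma zigzag (X Y Z : ob B) (f : hom B Y Z) (x : hom B X Y) :
  (1_f ** (lunit x \o ((ecell f ** 1_x) \o vinv (assoc (inv1 f) f x))))
    \o (assoc f (inv1 f) (hcomp1 f x) \o (icell f ** 1_(hcomp1 f x)))
  = lunit (hcomp1 f x).
Proof.
apply: (vcancel_r (assoc (id1 Z) f x)).
(* The right side has become [lunit f ** 1_x], which [inverse_coh] expands into the cells occurring
   on the left. *)
rewrite lunit_hcomp -(inverse_coh _ _ _ f) !whiskerr_vcomp -triangle !vassoc.
rewrite -(hcomp_vid _ _ _ _ f x) -assoc_nat !whiskerl_vcomp !vassoc; f_equal.
rewrite -(vassoc (assoc f (id1 _) x)).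
rewrite (assoc_nat _ _ _ _ _ _ _ _ _ _ _ 1_f (ecell f)) !vassoc; f_equal.
rewrite -(vassoc (assoc f (inv1 f) _)) pentagon !vassoc -(vassoc (1_f ** vinv _)).
by rewrite -whiskerl_vcomp vinvl hcomp_vid vidl.
Qed.

End Calculus.

(** * Tracked 1-cells *)

(* [nrm] selects one 1-cell out of [A] in each isomorphism class.  The hypotheses
   are kept in propositional form, so that the 2-cell attached to [w] and [w'] never
   has to be transported along an equality of normal forms. *)
Section Tracking.
Variables (B : bigroupoid) (A : ob B) (nrm : forall X, hom B A X -> Prop).
Hypothesis nrm_ex : forall X (w : hom B A X),
  exists w', nrm w' /\ inhabited (cell w w').
Hypothesis nrm_unique : forall X (w w' : hom B A X),
  nrm w -> nrm w' -> inhabited (cell w w') -> w = w'.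

(** The graph of the action of 1-cells on normal forms: by [acts_ex] and [acts_unique], a normal [w]
    is related to exactly one [w']. *)
Definition acts X Y (f : hom B X Y) (w : hom B A X) (w' : hom B A Y) : Prop :=
  nrm w /\ nrm w' /\ inhabited (cell (hcomp1 f w) w').

Lemma acts_ex X Y (f : hom B X Y) w : nrm w -> exists w', acts f w w'.
Proof. by move=> nw; case: (nrm_ex (hcomp1 f w)) => w' [nw' c]; exists w'. Qed.

Lemma acts_unique X Y (f : hom B X Y) w w' w'' :
  acts f w w' -> acts f w w'' -> w' = w''.
Proof.
move=> [_ [n' [c']]] [_ [n'' [c'']]]; apply: nrm_unique => //.
by constructor; exact: (c'' \o vinv c').
Qed.

Lemma acts_cell X Y (f g : hom B X Y) (a : cell f g) w w' :
  acts f w w' -> acts g w w'.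
Proof.
by move=> [n [n' [c]]]; do 2!split=> //; constructor; exact: (c \o (vinv a ** 1_w)).
Qed.

Lemma acts_comp X Y Z (g : hom B Y Z) (f : hom B X Y) w w' w'' :
  acts f w w' -> acts g w' w'' -> acts (hcomp1 g f) w w''.
Proof.
move=> [n [_ [c]]] [_ [n' [d]]]; do 2!split=> //.
by constructor; exact: (d \o (1_g ** c) \o assoc g f w).
Qed.

Lemma acts_comp_l X Y Z (g : hom B Y Z) (f : hom B X Y) w w' w'' :
  acts (hcomp1 g f) w w'' -> acts f w w' -> acts g w' w''.
Proof.
move=> [_ [n'' [d]]] [n [n' [c]]]; do 2!split=> //.
by constructor; exact: (d \o vinv (assoc g f w) \o (1_g ** vinv c)).
Qed.

Lemma acts_id X (w w' : hom B A X) : acts (id1 X) w w' -> w = w'.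
Proof.
move=> [n [n' [c]]]; apply: nrm_unique => //.
by constructor; exact: (c \o vinv (lunit w)).
Qed.

Lemma acts_inv X Y (f : hom B X Y) w w' : acts (inv1 f) w w' -> acts f w' w.
Proof.
move=> [n [n' [c]]]; do 2!split=> //; constructor.
exact: (lunit w \o (vinv (icell f) ** 1_w) \o vinv (assoc f (inv1 f) w)
  \o (1_f ** vinv c)).
Qed.

Record tracked X Y := Tracked {
  tr_hom :> hom B X Y;
  tr : forall w w', acts tr_hom w w' -> cell (hcomp1 tr_hom w) w'
}.

Lemma tr_irr X Y (f : tracked X Y) w w' (p q : acts f w w') : tr p = tr q.
Proof. by rewrite (proof_irrelevance _ p q). Qed.

Definition compatible X Y (f g : tracked X Y) (a : cell f g) : Prop :=
  forall w w' (p : acts f w w') (q : acts g w w'), tr q \o (a ** 1_w) = tr p.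

Definition step X Y (f : hom B X Y) w : hom B A Y :=
  proj1_sig (constructive_indefinite_description _ (nrm_ex (hcomp1 f w))).

Lemma acts_step X Y (f : hom B X Y) w : nrm w -> acts f w (step f w).
Proof. by rewrite /step; case: constructive_indefinite_description => w' []. Qed.

Definition tcomp X Y Z (g : tracked Y Z) (f : tracked X Y) : tracked X Z :=
  Tracked (tr_hom := hcomp1 g f) (fun w w'' p =>
    let q := acts_step f (proj1 p) in
    tr (acts_comp_l p q) \o (1_g ** tr q) \o assoc g f w).

(** [tcomp] computes its intermediate normal form by [step]. As it is unique, any [w'] at hand may
    replace it, and later proofs never unfold [step]. *)
Lemma tcompE X Y Z (g : tracked Y Z) (f : tracked X Y) w w' w''
  (p : acts (tcomp g f) w w'') (q : acts f w w') (r : acts g w' w'') :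
  tr p = tr r \o ((1_g ** tr q) \o assoc g f w).
Proof.
have e := acts_unique (acts_step f (proj1 p)) q; subst w'.
by rewrite /= vassoc (tr_irr _ q) (tr_irr _ r).
Qed.

(** [w] and [w'] are equal only propositionally, hence the match; [tidE] removes it once the two
    indices coincide. *)
Definition tid X : tracked X X :=
  Tracked (tr_hom := id1 X) (fun w w' p =>
    match acts_id p in _ = w1 return cell (hcomp1 (id1 X) w) w1 with
    | eq_refl => lunit w
    end).

Lemma tidE X (w : hom B A X) (p : acts (tid X) w w) : tr p = lunit w.
Proof. by rewrite /= (proof_irrelevance _ (acts_id p) eq_refl). Qed.

(** The mate of the inverse family: [inv1 f * w => inv1 f * (f * w') => (inv1 f * f) * w' => w'].
    This choice is what makes [ecell] and [icell] compatible. *)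
Definition tinv X Y (f : tracked X Y) : tracked Y X :=
  Tracked (tr_hom := inv1 f) (fun w w' p =>
    lunit w' \o ((ecell f ** 1_w') \o vinv (assoc (inv1 f) f w'))
      \o (1_(inv1 f) ** vinv (tr (acts_inv p)))).

Lemma tinvE X Y (f : tracked X Y) w w' (p : acts (tinv f) w w') (q : acts f w' w) :
  tr p = lunit w' \o ((ecell f ** 1_w') \o vinv (assoc (inv1 f) f w'))
      \o (1_(inv1 f) ** vinv (tr q)).
Proof. by rewrite /= (tr_irr _ q). Qed.

Lemma compatible_vcomp X Y (f g h : tracked X Y) (b : cell g h) (a : cell f g) :
  compatible b -> compatible a -> compatible (b \o a).
Proof.
move=> cb ca w w' p q.
by rewrite whiskerr_vcomp -vassoc (cb _ _ (acts_cell a p)) ca.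
Qed.

Lemma compatible_vid X Y (f : tracked X Y) : compatible (f := f) (g := f) 1_f.
Proof. by move=> w w' p q; rewrite hcomp_vid vidr; apply: tr_irr. Qed.

Lemma compatible_inverse X Y (f g : tracked X Y) (a : cell f g) (b : cell g f) :
  a \o b = 1_g -> compatible a -> compatible b.
Proof.
move=> ab ca w w' p q.
by rewrite -(ca _ _ q p) vassoc -whiskerr_vcomp ab hcomp_vid vidr.
Qed.

Lemma compatible_hcomp X Y Z (g g' : tracked Y Z) (f f' : tracked X Y)
  (b : cell g g') (a : cell f f') : compatible b -> compatible a ->
  compatible (f := tcomp g f) (g := tcomp g' f') (b ** a).
Proof.
move=> cb ca w w'' p q.
have [w' s] := acts_ex f (proj1 p).
have s' := acts_cell a s; have r := acts_comp_l p s; have r' := acts_comp_l q s'.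
rewrite (tcompE p s r) (tcompE q s' r') !vassoc assoc_nat.
rewrite -(cb _ _ r r') -(ca _ _ s s') -!vassoc; f_equal.
by rewrite !vassoc -!hcomp_vcomp !vidl !vidr.
Qed.

(** Passing to inverses in the compatibility of [a] brings [a] next to [inv2 a]; naturality of
    [ecell] then absorbs both. *)
Lemma compatible_inv X Y (f g : tracked X Y) (a : cell f g) : compatible a ->
  compatible (f := tinv f) (g := tinv g) (inv2 a).
Proof.
move=> ca w w' p q; have r := acts_inv p; have s := acts_inv q.
rewrite (tinvE p r) (tinvE q s).
have e : vinv (tr s) = (a ** 1_w') \o vinv (tr r).
  by apply: (vcancel_l (tr s)); rewrite vinvr -vassoc (ca _ _ r s) vinvr.
have e2 : inv2 a ** ((a ** 1_w') \o vinv (tr r))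
    = (inv2 a ** (a ** 1_w')) \o (1_(inv1 f) ** vinv (tr r)).
  by rewrite -hcomp_vcomp vidr.
rewrite e !vassoc /= -hcomp_vcomp vidl vidr e2 -(vassoc (vinv (assoc _ _ _))) assoc_natV.
rewrite !vassoc -(vassoc (ecell g ** _)) -whiskerr_vcomp -ecell_nat vidl.
by [].
Qed.

(** Each structure cell is compatible by a coherence law with a normal form as last argument: the
    pentagon here, then [lunit_hcomp], the triangle and, for [icell], [zigzag]. For [ecell] the
    families cancel by the choice of [tinv]. *)
Lemma compatible_assoc W X Y Z (h : tracked Y Z) (g : tracked X Y) (f : tracked W X) :
  compatible (f := tcomp (tcomp h g) f) (g := tcomp h (tcomp g f)) (assoc h g f).
Proof.
move=> w w3 p q.
have [w1 s1] := acts_ex f (proj1 p).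
have [w2 s2] := acts_ex g (proj1 (proj2 s1)).
have s3 : acts h w2 w3 by apply: acts_comp_l q _; apply: acts_comp s1 s2.
have t : acts (tcomp g f) w w2 := acts_comp s1 s2.
have u : acts (tcomp h g) w1 w3 := acts_comp s2 s3.
rewrite (tcompE p s1 u) (tcompE u s2 s3) (tcompE q t s3) (tcompE t s1 s2) /=.
rewrite !vassoc !whiskerl_vcomp !vassoc -pentagon; do 2!f_equal.
by rewrite -!vassoc -assoc_nat hcomp_vid.
Qed.

Lemma compatible_lunit X Y (f : tracked X Y) :
  compatible (f := tcomp (tid Y) f) (g := f) (lunit f).
Proof.
move=> w w' p q.
have u : acts (tid Y) w' w' by apply: acts_comp_l p q.
by rewrite (tcompE p q u) tidE -lunit_hcomp -!vassoc lunit_nat.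
Qed.

Lemma compatible_runit X Y (f : tracked X Y) :
  compatible (f := tcomp f (tid X)) (g := f) (runit f).
Proof.
move=> w w' p q.
have u : acts (tid X) w w.
  by move: (proj1 p) => n; do 2!split=> //; constructor; exact: lunit.
by rewrite (tcompE p u q) tidE -triangle.
Qed.

Lemma compatible_ecell X Y (f : tracked X Y) :
  compatible (f := tcomp (tinv f) f) (g := tid X) (ecell f).
Proof.
move=> w w1 p q; have e := acts_id q; subst w1.
have [w' s] := acts_ex f (proj1 p); have r := acts_comp_l p s.
rewrite tidE (tcompE p s r) (tinvE r s) !vassoc.
rewrite -(vassoc (1_(inv1 f) ** _)) -whiskerl_vcomp vinvl hcomp_vid vidl.
by rewrite vinvl vidr.
Qed.

Lemma compatible_icell X Y (f : tracked X Y) :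
  compatible (f := tid Y) (g := tcomp f (tinv f)) (icell f).
Proof.
move=> w w1 p q; have e := acts_id p; subst w1.
have [w' s] := acts_ex (inv1 f) (proj1 p); have r := acts_inv s.
rewrite tidE (tcompE (f := tinv f) q s r) (tinvE (f := f) s r).
(* By naturality this turns [lunit w] into [tr r \o lunit (hcomp1 f w')], to which [zigzag]
   applies. *)
apply: (vcancel_r (1_(id1 Y) ** tr r)).
have e : (icell f ** 1_w) \o (1_(id1 Y) ** tr r)
    = ((1_f ** 1_(inv1 f)) ** tr r) \o (icell f ** 1_(hcomp1 f w')).
  by rewrite hcomp_vid -!hcomp_vcomp !vidl !vidr.
rewrite (whiskerl_vcomp _ (lunit w' \o _)) -lunit_nat -zigzag !vassoc /= e.
do 2!f_equal; rewrite -(vassoc (assoc _ _ _)) assoc_nat !vassoc.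
by rewrite -!vassoc -!whiskerl_vcomp vinvl !hcomp_vid vidl.
Qed.

Definition tcell X Y (f g : tracked X Y) : Type :=
  {a : cell f g | compatible a}.

Lemma tcell_eq X Y (f g : tracked X Y) (a b : tcell f g) :
  proj1_sig a = proj1_sig b -> a = b.
Proof. exact: eq_sig_hprop (fun _ => @proof_irrelevance _) _ _. Qed.

(** The axioms of a bigroupoid equate 2-cells only, never 1-cells, so they are inherited from [B]
    through [tcell_eq]. Inverses of 2-cells stay compatible by [compatible_inverse]. *)
Definition tracking : bigroupoid.
Proof.
refine (@Bigroupoid (ob B) tracked tcell
  (fun _ _ _ _ _ b a => exist _ _ (compatible_vcomp (proj2_sig b) (proj2_sig a)))
  (fun _ _ f => exist _ _ (@compatible_vid _ _ f)) _ _ _ _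
  tcomp
  (fun _ _ _ _ _ _ _ b a => exist _ _ (compatible_hcomp (proj2_sig b) (proj2_sig a)))
  _ _ tid tinv
  (fun _ _ _ _ a => exist _ _ (compatible_inv (proj2_sig a))) _ _
  (fun _ _ _ _ h g f => exist _ _ (@compatible_assoc _ _ _ _ h g f)) _
  (fun _ _ f => exist _ _ (@compatible_lunit _ _ f)) _
  (fun _ _ f => exist _ _ (@compatible_runit _ _ f)) _
  (fun _ _ f => exist _ _ (@compatible_ecell _ _ f)) _
  (fun _ _ f => exist _ _ (@compatible_icell _ _ f)) _ _ _ _).
4: { move=> X Y f g [a ca]; have [b [ba ab]] := vgroupoid _ _ _ _ _ a.
     by exists (exist _ b (compatible_inverse ab ca)); split; apply: tcell_eq. }
all: intros; apply: tcell_eq => /=.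
- exact: vassoc.
- exact: vidl.
- exact: vidr.
- exact: hcomp_vcomp.
- exact: hcomp_vid.
- exact: inv_vcomp.
- exact: inv_vid.
- exact: assoc_nat.
- exact: lunit_nat.
- exact: runit_nat.
- exact: ecell_nat.
- exact: icell_nat.
- exact: pentagon.
- exact: triangle.
- exact: inverse_coh.
Defined.

Definition untrack : strict_morphism tracking B.
Proof.
by refine (@StrictMorphism tracking B (fun X => X) (fun _ _ f => tr_hom f)
  (fun _ _ _ _ a => proj1_sig a) _ _ _ _ _ _ _ _ _ _ _ _) => *;
  (reflexivity || apply: cell_heq_refl).
Defined.

Definition track X Y (f : hom B X Y) : tracked X Y :=
  Tracked (fun w w' (p : acts f w w') => proj1_sig
    (constructive_indefinite_description (fun _ : cell (hcomp1 f w) w' => True)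
      (match proj2 (proj2 p) with inhabits c => ex_intro _ c I end))).

(** Cancelling the family cell gives [a ** 1_w = b ** 1_w] for the normal form [w] of [id1 A];
    interchange with [c : cell (id1 A) w] moves this to [id1 A]. *)
Lemma compatible_unique Y (f g : tracked A Y) (a b : cell f g) :
  compatible a -> compatible b -> a = b.
Proof.
move=> ca cb; have [w [nw [c]]] := nrm_ex (id1 A).
have [w' p] := acts_ex f nw; have q := acts_cell a p.
have e : a ** 1_w = b ** 1_w by apply: (vcancel_l (tr q)); rewrite (ca _ _ p) (cb _ _ p).
apply: whiskerr_id1_inj; apply: (vcancel_l (1_g ** c)).
by rewrite -(hcomp_split_r a) -(hcomp_split_r b) (hcomp_split_l a) (hcomp_split_l b) e.
Qed.

End Tracking.

(** * Coherence *)

Section Representatives.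
Variables (B : bigroupoid) (X Y : ob B).

Definition rep (f : hom B X Y) : hom B X Y :=
  proj1_sig (constructive_indefinite_description (fun g => inhabited (cell f g))
    (ex_intro _ f (inhabits (vid f)))).

Lemma rep_cell f : inhabited (cell f (rep f)).
Proof. by rewrite /rep; case: constructive_indefinite_description. Qed.

(** The choice made by [rep] depends only on the predicate of being isomorphic to [f], and
    extensionality identifies the predicates of [f] and [g]. *)
Lemma rep_eq f g : inhabited (cell f g) -> rep f = rep g.
Proof.
move=> [c]; rewrite /rep.
have e : (fun h => inhabited (cell f h)) = (fun h => inhabited (cell g h)).
  apply: functional_extensionality => h; apply: propositional_extensionality.
  by split=> -[d]; constructor; [exact: (d \o vinv c) | exact: (d \o c)].
move: (ex_intro _ f _) (ex_intro _ g _); rewrite e => p q.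
by rewrite (proof_irrelevance _ p q).
Qed.

Lemma rep_inj f g : rep f = rep g -> inhabited (cell f g).
Proof.
move=> e; have [c] := rep_cell f; have := rep_cell g; rewrite -e => -[d].
by constructor; exact: (vinv d \o c).
Qed.

Lemma rep_idem f : rep (rep f) = rep f.
Proof.
by symmetry; apply: rep_eq; exact: rep_cell.
Qed.

End Representatives.

(** * Parallel 2-cells of the free bigroupoid are equal *)

Section FreeBigroupoid.
Variables (G : graph) (Fb : bigroupoid) (Ib : graph_morphism G (underlying Fb)).
Hypothesis Hb : is_free_bigroupoid Ib.

Lemma free_unique (B : bigroupoid) (F F' : strict_morphism Fb B) :
  sm_after_gm F Ib = sm_after_gm F' Ib -> F = F'.
Proof.
have [K [_ u]] := Hb (sm_after_gm F Ib).
by move=> e; rewrite -(u F) // -(u F').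
Qed.

Lemma sm_after_idm : sm_after_gm (sm_idm Fb) Ib = Ib.
Proof. by case: Ib. Qed.

Lemma free_cell_unique X Y (f g : hom Fb X Y) (a b : cell f g) : a = b.
Proof.
pose nrm Z (w : hom Fb X Z) := rep w = w.
have nrm_ex Z (w : hom Fb X Z) : exists w', nrm Z w' /\ inhabited (cell w w').
  by exists (rep w); split; [exact: rep_idem | exact: rep_cell].
have nrm_unique Z (w w' : hom Fb X Z) :
    nrm Z w -> nrm Z w' -> inhabited (cell w w') -> w = w'.
  by move=> n n' c; rewrite -n -n'; apply: rep_eq.
pose T := tracking nrm_ex nrm_unique.
pose It : graph_morphism G (underlying T) :=
  @GraphMorphism G (underlying T) (gm0 Ib) (fun _ _ e => track nrm (gm1 Ib e)).
have [K [eK _]] := Hb It.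
pose F := sm_comp (untrack nrm_ex nrm_unique) K.
have eF : F = sm_idm Fb.
  apply: free_unique; rewrite sm_after_idm.
  transitivity (sm_after_gm (untrack nrm_ex nrm_unique) (sm_after_gm K Ib)) => //.
  by rewrite eK /It; case: (Ib).
(* [compatible_unique] concerns 1-cells out of [X], but [sm1 K f] starts at [sm0 K X]. Keeping the
   equation of objects as a premise lets [eF] be rewritten without transports. *)
suff H : sm0 F X = X -> sm2 F a = sm2 F b by move: H; rewrite eF; apply.
rewrite /=; case: (sm2 K a) (sm2 K b) => a' ca [b' cb] /=.
move: (sm1 K f) (sm1 K g) a' b' ca cb => f' g' a' b' ca cb e.
by move: f' g' a' b' ca cb; rewrite e => f' g' a' b'; apply: compatible_unique.
Qed.

End FreeBigroupoid.
(** * The quotient groupoid of 1-cells up to isomorphism *)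

Section Quotient.
Variable B : bigroupoid.

(** Isomorphism classes, encoded by their chosen representatives. *)
Definition class (X Y : ob B) : Type := {f : hom B X Y | rep f = f}.

Definition cls (X Y : ob B) (f : hom B X Y) : class X Y := exist _ (rep f) (rep_idem f).

Lemma cls_eq (X Y : ob B) (f g : hom B X Y) : inhabited (cell f g) -> cls f = cls g.
Proof. by move=> c; apply: subset_eq_compat; apply: rep_eq. Qed.

Lemma cls_inj (X Y : ob B) (f g : hom B X Y) : cls f = cls g -> inhabited (cell f g).
Proof. by move=> [] e; apply: rep_inj. Qed.

Lemma cls_surj (X Y : ob B) (x : class X Y) : exists f, x = cls f.
Proof. by case: x => f e; exists f; apply: subset_eq_compat. Qed.

Definition class_comp (X Y Z : ob B) (y : class Y Z) (x : class X Y) : class X Z :=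
  cls (hcomp1 (proj1_sig y) (proj1_sig x)).

Definition class_inv (X Y : ob B) (x : class X Y) : class Y X :=
  cls (inv1 (proj1_sig x)).

Lemma cls_comp (X Y Z : ob B) (g : hom B Y Z) (f : hom B X Y) :
  cls (hcomp1 g f) = class_comp (cls g) (cls f).
Proof.
apply: cls_eq; have [b] := rep_cell g; have [a] := rep_cell f.
by constructor; exact: (b ** a).
Qed.

Lemma cls_inv (X Y : ob B) (f : hom B X Y) : cls (inv1 f) = class_inv (cls f).
Proof. by apply: cls_eq; have [a] := rep_cell f; constructor; exact: inv2 a. Qed.

Definition quotient : groupoid.
Proof.
refine (@Groupoid (ob B) class class_comp (fun X => cls (id1 X)) class_inv _ _ _ _ _).
- move=> W X Y Z h g f.
  have [h' ->] := cls_surj h; have [g' ->] := cls_surj g; have [f' ->] := cls_surj f.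
  by rewrite -!cls_comp; apply: cls_eq; constructor; exact: assoc.
- move=> X Y f; have [f' ->] := cls_surj f.
  by rewrite -!cls_comp; apply: cls_eq; constructor; exact: lunit.
- move=> X Y f; have [f' ->] := cls_surj f.
  by rewrite -!cls_comp; apply: cls_eq; constructor; exact: runit.
- move=> X Y f; have [f' ->] := cls_surj f.
  by rewrite -cls_inv -!cls_comp; apply: cls_eq; constructor; exact: ecell.
- move=> X Y f; have [f' ->] := cls_surj f.
  by rewrite -cls_inv -!cls_comp; apply: cls_eq; constructor; exact: icell.
Defined.

Definition proj_quotient : strict_morphism B (disc quotient) :=
  to_disc (D := quotient) (fun X => X) cls
    (fun X Y f g a => cls_eq (inhabits a)) cls_comp (fun X => eq_refl) cls_inv.

End Quotient.

Definition to_codisc (B : bigroupoid) (T : Type) (F0 : ob B -> T) :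
  strict_morphism B (disc (codisc T)) :=
  to_disc (D := codisc T) F0 (fun _ _ _ => tt)
    (fun _ _ _ _ _ => eq_refl) (fun _ _ _ _ _ => eq_refl) (fun _ => eq_refl)
    (fun _ _ _ => eq_refl).

(** * Comparison of the free bigroupoid with the free 2-groupoid *)

Section Comparison.
Variables (G : graph) (Fb : bigroupoid) (Ib : graph_morphism G (underlying Fb)).
Hypothesis Hb : is_free_bigroupoid Ib.
Variables (Fs : bigroupoid) (Gam : strict_morphism Fb Fs).
Hypothesis Hs : is_free_2groupoid (sm_after_gm Gam Ib).

(** Extend [F] restricted to generators along the unit of [Fs]; the composite with [Gam] agrees with
    [F] on generators, and [Fb] is free. *)
Lemma factor_2groupoid (B : bigroupoid) (F : strict_morphism Fb B) :
  is_2groupoid B -> exists K : strict_morphism Fs B, sm_comp K Gam = F.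
Proof.
move=> B2; have [_ H] := Hs; have [K [e _]] := H B B2 (sm_after_gm F Ib).
by exists K; apply: (free_unique Hb).
Qed.

Lemma cell_of_eq_image X Y (f g : hom Fb X Y) :
  sm1 Gam f = sm1 Gam g -> inhabited (cell f g).
Proof.
move=> e; apply: cls_inj.
have [K eK] := factor_2groupoid (proj_quotient Fb) (disc_is_2groupoid _).
suff : sm1 (proj_quotient Fb) f = sm1 (proj_quotient Fb) g by [].
by rewrite -eK /= e.
Qed.

Lemma sm0_inj X Y : sm0 Gam X = sm0 Gam Y -> X = Y.
Proof.
have [K eK] :=
  factor_2groupoid (to_codisc (T := ob Fb) (fun X => X)) (disc_is_2groupoid _).
have E Z : sm0 K (sm0 Gam Z) = Z by move: (f_equal (fun F => sm0 F Z) eK).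
by move=> e; rewrite -(E X) e E.
Qed.

(** Indexing by objects of [Fb] ensures that composable 1-cells of the image have composable
    preimages. *)
Definition image (X Y : ob Fb) : Type :=
  {u : hom Fs (sm0 Gam X) (sm0 Gam Y) | exists f, sm1 Gam f = u}.

Definition image_comp X Y Z (v : image Y Z) (u : image X Y) : image X Z.
Proof.
exists (hcomp1 (proj1_sig v) (proj1_sig u)).
case: u v => u [f eu] [v [g ev]]; exists (hcomp1 g f) => /=.
by rewrite sm1_hcomp eu ev.
Defined.

Definition image_id X : image X X.
Proof. exists (id1 (sm0 Gam X)), (id1 X); exact: sm1_id. Defined.

Definition image_inv X Y (u : image X Y) : image Y X.
Proof.
exists (inv1 (proj1_sig u)); case: u => u [f eu]; exists (inv1 f) => /=.
by rewrite sm1_inv eu.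
Defined.

(** A structure cell of [Fs] being an identity includes the equality of its source and target
    1-cells, which is the corresponding groupoid law. *)
Definition image_groupoid : groupoid.
Proof.
refine (@Groupoid (ob Fb) image image_comp image_id image_inv _ _ _ _ _);
  case: (proj1 Hs) => Ha [Hl [Hr [He Hi]]];
  intros; apply: eq_sig_hprop => [? *|/=]; try exact: proof_irrelevance.
- by case: (Ha _ _ _ _ (proj1_sig h) (proj1_sig g) (proj1_sig f)).
- by case: (Hl _ _ (proj1_sig f)).
- by case: (Hr _ _ (proj1_sig f)).
- by case: (He _ _ (proj1_sig f)).
- by case: (Hi _ _ (proj1_sig f)).
Defined.

Definition image_incl : strict_morphism (disc image_groupoid) Fs :=
  from_disc (D := image_groupoid) (proj1 Hs) (sm0 Gam) (fun _ _ u => proj1_sig u)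
    (fun _ _ _ _ _ => eq_refl) (fun _ => eq_refl) (fun _ _ _ => eq_refl).

(** The generators lie in the image, so [Fs] maps to it; followed by the inclusion, this map fixes
    the generators and is the identity by uniqueness. *)
Lemma image_retract : exists K : strict_morphism Fs (disc image_groupoid),
  sm_comp image_incl K = sm_idm Fs.
Proof.
have [F2 H] := Hs.
pose It : graph_morphism G (underlying (disc image_groupoid)) :=
  @GraphMorphism G (underlying (disc image_groupoid)) (gm0 Ib)
    (fun _ _ e => exist _ (sm1 Gam (gm1 Ib e)) (ex_intro _ (gm1 Ib e) eq_refl)).
have [K [eK _]] := H _ (disc_is_2groupoid _) It; exists K.
have [J [_ uJ]] := H Fs F2 (sm_after_gm Gam Ib).
rewrite -(uJ (sm_idm Fs)) // -(uJ (sm_comp image_incl K)) //.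
exact: (f_equal (sm_after_gm image_incl) eK).
Qed.

Lemma target_is_id2 X Y (u v : hom Fs X Y) (a : cell u v) : is_id2 a.
Proof.
have [K eK] := image_retract.
(* The composite is the identity of [Fs], yet [image_incl] sends every 2-cell to some
   [id2_of_eq]. *)
suff : is_id2 (sm2 (sm_comp image_incl K) a) by rewrite eK.
exact: is_id2_of_eq.
Qed.

Lemma sm0_surj Y : exists X, Y = sm0 Gam X.
Proof.
have [K eK] := image_retract; exists (sm0 K Y).
by rewrite -{1}[Y]/(sm0 (sm_idm Fs) Y) -eK.
Qed.

Lemma sm1_surj X Y (u : hom Fs (sm0 Gam X) (sm0 Gam Y)) : exists f, sm1 Gam f = u.
Proof.
have [K eK] := image_retract.
(* Passing through the image preserves endpoints only propositionally, so 1-cells are compared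
   packed with them. [sm0_inj] then aligns the endpoints and [inj_pair2] unpacks. *)
pose total U V (v : hom Fs U V) : {U & {V & hom Fs U V}} := existT _ U (existT _ V v).
have [X' [Y' [f e]]] :
    exists X' Y' (f : hom Fb X' Y'), total _ _ u = total _ _ (sm1 Gam f).
  rewrite -[total _ _ u]/(total _ _ (sm1 (sm_idm Fs) u)) -eK /=.
  case: (sm1 K u) => v [f ef]; exists (sm0 K (sm0 Gam X)), (sm0 K (sm0 Gam Y)), f.
  by rewrite ef.
have eX : X' = X by apply: sm0_inj; move: (f_equal (@projT1 _ _) e).
have eY : Y' = Y by apply: sm0_inj; move: (f_equal (fun t => projT1 (projT2 t)) e).
subst X' Y'; exists f; symmetry.
by apply: inj_pair2; apply: inj_pair2 e.
Qed.

(** The inverse functor picks preimages of 1-cells, and its 2-cells and the unit are arbitrary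
    choices. All equations hold because parallel 2-cells are equal in [Fb], and also in [Fs], where
    all are identities. *)
Lemma comparison_hom_equivalence X Y : hom_equivalence Gam X Y.
Proof.
pose G1 (u : hom Fs (sm0 Gam X) (sm0 Gam Y)) :=
  constructive_indefinite_description _ (sm1_surj u).
have pick P : inhabited P -> P.
  move=> /(fun H => match H with inhabits x => ex_intro (fun _ : P => True) x I end).
  by move=> /constructive_indefinite_description [].
exists (fun u => proj1_sig (G1 u)).
unshelve eexists.
  move=> u v a; apply: pick; apply: cell_of_eq_image.
  by rewrite (proj2_sig (G1 u)) (proj2_sig (G1 v)); case: (target_is_id2 a).
unshelve eexists.
  by move=> f; apply: pick; apply: cell_of_eq_image; rewrite (proj2_sig (G1 _)).
unshelve eexists.
  by move=> u; rewrite (proj2_sig (G1 u)); exact: vid.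
split; first by move=> *; apply: (free_cell_unique Hb).
split; first by move=> *; apply: (free_cell_unique Hb).
split; first by move=> *; apply: (free_cell_unique Hb).
split; first by move=> *; apply: vgroupoid.
split; last by move=> *; apply: vgroupoid.
by move=> *; apply: is_id2_unique; apply: target_is_id2.
Qed.

End Comparison.

Theorem theoremB9 (G : graph)
  (Fb : bigroupoid) (Ib : graph_morphism G (underlying Fb))
  (Hb : is_free_bigroupoid Ib)
  (Fs : bigroupoid) (Is : graph_morphism G (underlying Fs))
  (Hs : is_free_2groupoid Is)
  (Gam : strict_morphism Fb Fs) (HGam : sm_after_gm Gam Ib = Is) :
  biequivalence Gam /\ (forall X Y : ob Fb, hom_faithful Gam X Y).
Proof.
subst Is; split; last by move=> X Y f g a b _; apply: (free_cell_unique Hb).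
split; last exact: (comparison_hom_equivalence Hb Hs).
(* Every 0-cell is strictly in the image, so an identity 1-cell suffices. *)
move=> Y; have [X ->] := sm0_surj Hs Y; exists X; constructor; exact: id1.
Qed.
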